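(* Let $G$ be any group with subgroups $H$ and $K$. Suppose $Y$ is a $K$-almost invariant set arising from a splitting of $G$ over $K$. Suppose further that $Y$ contains some nonempty subset $X'$ that is stabilized by $H$, i.e. $hX'=X'$ for all $h\in H$ (equivalently, $Y$ contains at least one right coset $Hg$). Let $g_0\in Y^*$. Then $$Hg_0\cap Y^* = (H\cap K)g_0\cap Y^*,$$ so that $Hg_0\cap Y^*$ is both $H$-finite and $K$-finite.
   Context: For a subset $Y$ of a group $G$, $Y^*=G\setminus Y$. A subset of $G$ is $H$-finite if it is contained in finitely many right cosets $Hg_i$. A $G$-tree is a simplicial tree with a simplicial $G$-action that inverts no edge. A splitting of $G$ is a $G$-tree $T$ with no global fixed point such that $G\backslash T$ has exactly one edge; it is a splitting over $K$ if $K$ is the stabilizer of an edge of $T$ (so $K$ is well-defined up to conjugacy). A $K$-almost invariant set arising from a splitting with tree $T$ is a set of the form $Y=\{g\in G : e \text{ points away from } gv\}$, where $v$ is a vertex of $T$ and $e$ is a directed edge of $T$ with stabilizer $K$; ''$e$ points away from $gv$'' means that $gv$ lies in the component of $T$ minus the interior of $e$ that contains the initial vertex of $e$. The convention is that $K=\mathrm{Stab}(e)=\{g\in G: gY=Y\}$. *)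

(* Defs.v *)
From HB Require Import structures.
From mathcomp Require Export all_boot.
From mathcomp Require Export boolp classical_sets cardinality.

Set Implicit Arguments.
Unset Strict Implicit.
Unset Printing Implicit Defensive.

Local Open Scope classical_set_scope.
Local Open Scope group_scope.

(** Subsets of an arbitrary (possibly infinite) group *)

Definition is_subgroup (G : groupType) (H : set G) : Prop :=
  group_closed (mem H).

Definition left_translate (G : groupType) (g : G) (A : set G) : set G :=
  [set g * x | x in A].

Definition right_coset (G : groupType) (H : set G) (g : G) : set G :=
  [set h * g | h in H].

(* [rel_finite H A] reads: A is H-finite. *)
Definition rel_finite (G : groupType) (H A : set G) : Prop :=
  exists2 C : set G, finite_set C & A `<=` \bigcup_(g in C) right_coset H g.

(** Simplicial trees *)

(* The analogue of [connect], which is only available on finite types. *)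
Definition joined (V : Type) (r : rel V) (x y : V) : Prop :=
  exists2 p : seq V, path r x p & last x p = y.

(* A 1-dimensional simplicial complex is a simple graph, given here by its
   adjacency relation.  The size condition in [tree_acyclic] is there because
   [ucycle adj [:: x; y]] holds as soon as x and y are adjacent. *)
Record is_tree (V : eqType) (adj : rel V) : Prop := IsTree {
  tree_inhabited : inhabited V;
  tree_sym : symmetric adj;
  tree_irr : irreflexive adj;
  tree_connected : forall x y, joined adj x y;
  tree_acyclic : forall c : seq V, ucycle adj c -> (size c <= 2)%N }.

Record gtree (G : groupType) := GTree {
  vertex :> eqType;
  adj : rel vertex;
  act : G -> vertex -> vertex;
  gtree_is_tree : is_tree adj;
  act_one : forall x, act 1 x = x;
  act_mul : forall g h x, act (g * h) x = act g (act h x);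
  act_adj : forall g x y, adj (act g x) (act g y) = adj x y;
  act_noinv : forall g x y, adj x y -> ~ (act g x = y /\ act g y = x) }.

Section GTree.
Variables (G : groupType) (T : gtree G).

(* A directed edge is a pair e of adjacent vertices, from e.1 to e.2. *)
Definition is_edge (e : T * T) : Prop := adj e.1 e.2.

Definition act_edge (g : G) (e : T * T) : T * T := (act g e.1, act g e.2).

Definition same_edge (e f : T * T) : bool := (f == e) || (f == (e.2, e.1)).

(* As there are no inversions, this is also the stabilizer of the underlying
   undirected edge. *)
Definition edge_stab (e : T * T) : set G := [set g | act_edge g e = e].

(* A group element fixing an interior point of an edge and not inverting it
   fixes its endpoints, so a global fixed point may be taken to be a vertex. *)
Definition is_splitting : Prop :=
  (~ exists x : T, forall g : G, act g x = x) /\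
  (exists2 e : T * T, is_edge e &
     forall f : T * T, is_edge f -> exists g : G, same_edge (act_edge g e) f).

Definition adj_minus (e : T * T) : rel T :=
  [rel x y | adj x y && ~~ same_edge e (x, y)].

(* The directed edge e points away from x. *)
Definition points_away (e : T * T) (x : T) : Prop :=
  joined (adj_minus e) e.1 x.

End GTree.

(* That K is moreover {g | gY = Y} is a consequence of this definition, and is
   therefore not imposed. *)
Definition arises_from_splitting (G : groupType) (K Y : set G) : Prop :=
  exists (T : gtree G) (e : T * T) (v : T),
    [/\ is_splitting T, is_edge e, K = edge_stab e &
        Y = [set g | points_away e (act g v)]].

(* Main.v *)
Require Import Defs.

Set Implicit Arguments.
Unset Strict Implicit.
Unset Printing Implicit Defensive.

(** Let A be the set of vertices from which e points away.  The only edge leaving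
    A is e.  Suppose h in H maps a vertex outside A outside A but does not fix e.
    Then e and h e are distinct edges, and since both A and its complement meet
    their translates by h, the sets A and h^-1 A are nested.  Replacing h by its
    inverse, h^-1 A is contained in A, and then the neighbours of h^-1 A all lie
    in A, so that a vertex at distance n from h^-n A is in A.  But a vertex x v
    with H x contained in Y lies in every h^-n A, hence A is everything. *)

Local Open Scope classical_set_scope.
Local Open Scope group_scope.

Section PointsAway.
Variables (G : groupType) (T : gtree G) (e : T * T).
Hypothesis edge_e : is_edge e.
Implicit Types (g h : G) (x y z : T).

Let A := points_away e.

Lemma points_away_init : A e.1.
Proof. by exists [::]. Qed.

Lemma adj_sym x y : adj x y = adj y x.
Proof. exact: (tree_sym (gtree_is_tree T)). Qed.

(** A path from [e.1] to [x] avoiding [e] extends to [y] unless the last step runs along [e];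
    running backwards is excluded, since then [y] would be [e.1]. *)
Lemma points_away_boundary x y : A x -> adj x y -> ~ A y -> (x, y) = e.
Proof.
move=> [p pp px] xy nAy; case: (boolP (same_edge e (x, y))) => [|nexy].
  case/orP=> [/eqP//|/eqP[_ y1]].
  by case: nAy; rewrite y1; exact: points_away_init.
case: nAy; exists (rcons p y); last by rewrite last_rcons.
by rewrite rcons_path pp px /adj_minus /= xy nexy.
Qed.

Lemma path_closed (Q : T -> Prop) x :
  (forall y z, Q y -> adj y z -> Q z) -> Q x -> forall y, Q y.
Proof.
move=> Qadj Qx y.
have [p pp <-] := tree_connected (gtree_is_tree T) x y.
elim: p x Qx pp => //= z p IH x Qx /andP[xz pz].
exact: (IH z (Qadj _ _ Qx xz) pz).
Qed.

Lemma points_away_contract h x :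
  act_edge h e <> e -> (forall z, A (act h z) -> A z) ->
  (forall n, A (act (h ^+ n) x)) -> forall y, A y.
Proof.
move=> he hA Ax y.
(* If [(z, z')] left [A], its image under [h] would leave [A] too, so both would equal [e], against
   [he]. *)
have step z z' : A (act h z) -> adj z z' -> A z'.
  move=> Ahz zz'; apply: contrapT => nAz'.
  have E := points_away_boundary (hA _ Ahz) zz' nAz'.
  have hzz' : adj (act h z) (act h z') by rewrite act_adj.
  have E' := points_away_boundary Ahz hzz' (fun H => nAz' (hA _ H)).
  by apply: he; rewrite -{1}E.
have [p pp <-] := tree_connected (gtree_is_tree T) x y.
(* Each edge of the path from [x] to [y] uses up one power of [h]. *)
have {Ax} := Ax (size p).
elim: p x pp => [|z p IH] x /=; first by rewrite expg0 act_one.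
move=> /andP[xz pz]; rewrite expgS act_mul => Ax.
by apply: IH pz _; apply: step Ax _; rewrite act_adj.
Qed.

Lemma points_away_nested h c d :
  A c -> A (act h c) -> ~ A d -> ~ A (act h d) -> act_edge h e <> e ->
  (forall z, A (act h z) -> A z) \/ (forall z, A z -> A (act h z)).
Proof.
move=> Ac Ahc nAd nAhd he.
have noinv x y : (x, y) = e -> (act h y, act h x) <> e.
  move=> xye; rewrite -xye => -[yx xy].
  by apply: (@act_noinv _ _ h x y) => //; have := edge_e; rewrite -xye.
have hfix x y : (x, y) = e -> (act h x, act h y) <> e.
  by move=> xye; rewrite -{1}xye in he.
pose s x := `[< A x >]; pose t x := s (act h x).
have cross x y : adj x y -> s x != s y -> (x, y) = e \/ (y, x) = e.
  move=> xy; rewrite /s; case: asboolP => Ax; case: asboolP => Ay // _.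
    by left; exact: points_away_boundary.
  by right; apply: points_away_boundary; rewrite // adj_sym.
have hcross x y : adj x y -> t x != t y ->
    (act h x, act h y) = e \/ (act h y, act h x) = e.
  by move=> xy; apply: cross; rewrite act_adj.
(* The side of [A] on which [h^-1 e] lies, and the side of [h^-1 A] on which [e] lies. *)
pose al := s (act h^-1 e.1); pose be := t e.1.
(* An edge crossing both boundaries would force [h] to fix or to invert [e]. *)
have st x y : adj x y -> s x != s y -> t x = t y.
  move=> xy sxy; apply/eqP; apply: contraT => txy.
  have [xe|xe] := cross _ _ xy sxy; have [ye|ye] := hcross _ _ xy txy.
  - by case: (hfix _ _ xe).
  - by case: (noinv _ _ xe).
  - by case: (noinv _ _ xe).
  - by case: (hfix _ _ xe).
have sbe x y : adj x y -> s x != s y -> t x = be /\ t y = be.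
  move=> xy sxy; rewrite -(st _ _ xy sxy) /be.
  by have [<-|<-] := cross _ _ xy sxy => //=; rewrite -(st _ _ xy sxy).
have tal x y : adj x y -> t x != t y -> s x = al /\ s y = al.
  move=> xy txy.
  have sxy : s x = s y.
    by apply/eqP; apply: contraT => /(st _ _ xy) E; rewrite E eqxx in txy.
  rewrite -sxy /al.
  by have [<-|<-] := hcross _ _ xy txy => /=; rewrite -act_mul mulVg act_one.
(* No edge leaves the corner of A and h^-1 A opposite to the one given by the
   sides al and be of the two boundary edges; by connectedness this corner is
   empty. *)
have corner x y : s x = ~~ al -> t x = ~~ be -> s y = ~~ al /\ t y = ~~ be.
  move=> sx tx; apply: (path_closed (Q := fun y => s y = ~~ al /\ t y = ~~ be)
    (x := x)) => // {}x {}y [{}sx {}tx] xy.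
  split.
    have [<-//|/(sbe _ _ xy)[]] := eqVneq (s x) (s y).
    by rewrite tx; case: (be).
  have [<-//|/(tal _ _ xy)[]] := eqVneq (t x) (t y).
  by rewrite sx; case: (al).
have sc : s c by apply/asboolP. have tc : t c by apply/asboolP.
have sd : s d = false by apply/asboolP.
have td : t d = false by apply/asboolP.
clear sbe tal; clearbody al be; case: al corner; case: be => corner.
(* If [al] and [be] agree, the empty corner contains [d] or [c]; if they differ, its emptiness is
   one of the two inclusions. *)
- by have [] := corner d c sd td; rewrite sc.
- left=> z /asboolP tz; apply: contrapT => /asboolPn/negbTE sz.
  by have [] := corner z c sz tz; rewrite sc.
- right=> z /asboolP sz; apply: contrapT => /asboolPn/negbTE tz.
  by have [] := corner z d sz tz; rewrite sd.
- by have [] := corner c d sc tc; rewrite sd.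
Qed.

Lemma edge_stab_of_bounded_orbit h c d :
  (forall n, A (act (h ^+ n) c)) -> (forall n, A (act (h^-1 ^+ n) c)) ->
  ~ A d -> ~ A (act h d) -> edge_stab e h.
Proof.
move=> hc hVc nAd nAhd; apply: contrapT => he.
have Ac : A c by have := hc 0%N; rewrite expg0 act_one.
have Ahc : A (act h c) by have := hc 1%N; rewrite expg1.
have [hA|hA] := points_away_nested Ac Ahc nAd nAhd he.
  exact/nAd/(points_away_contract he hA hc).
(* The reverse inclusion is the contraction hypothesis for [h^-1]. *)
apply/nAd/(points_away_contract (h := h^-1) _ _ hVc) => [hVe|z /hA].
  by apply: he; rewrite /edge_stab /= -{1}hVe /act_edge /=
    -!act_mul mulgV !act_one; case: (e).
by rewrite -act_mul mulgV act_one.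
Qed.

End PointsAway.

Theorem lemma4p1 (G : groupType) (H K Y X' : set G) (g0 : G)
    (subgroupH : is_subgroup H) (subgroupK : is_subgroup K)
    (splitY : arises_from_splitting K Y)
    (X'neq0 : X' !=set0) (X'Y : X' `<=` Y)
    (stabX' : forall h : G, H h -> left_translate h X' = X')
    (Yg0 : (~` Y) g0) :
  [/\ right_coset H g0 `&` ~` Y = right_coset (H `&` K) g0 `&` ~` Y,
      rel_finite H (right_coset H g0 `&` ~` Y) &
      rel_finite K (right_coset H g0 `&` ~` Y)].
Proof.
have eqHK : right_coset H g0 `&` ~` Y = right_coset (H `&` K) g0 `&` ~` Y.
  case: splitY => T [e [v [_ edge_e KE YE]]].
  case: X'neq0 => x X'x.
  (* As [X'] is stable under [H], the whole [H]-orbit of the vertex [act x v] stays on the side of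
     [e.1]. *)
  have HxY h : H h -> points_away e (act h (act x v)).
    move=> Hh; rewrite -act_mul.
    have : Y (h * x) by apply: X'Y; rewrite -(stabX' h Hh); exists x.
    by rewrite YE.
  have [H1 _] := subgroupH.
  have HV h : H h -> H h^-1.
    by have := @group_closedV _ _ subgroupH h; rewrite !inE.
  have HX h n : H h -> H (h ^+ n).
    move=> Hh; elim: n => [|n IH]; first by move: H1; rewrite inE expg0.
    have := @group_closedM _ _ subgroupH h (h ^+ n).
    by rewrite !inE -expgS; exact.
  apply/seteqP; split=> [_ [[h Hh <-] nYh]|_ [[h [Hh _] <-] nYh]]; last first.
    by split=> //; exists h.
  split=> //; exists h => //; split=> //; rewrite KE.
  apply: (edge_stab_of_bounded_orbit edge_e (c := act x v) (d := act g0 v)).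
  - by move=> n; exact/HxY/HX.
  - by move=> n; exact/HxY/HX/HV.
  - by move: Yg0; rewrite YE.
  - by move: nYh; rewrite YE /= act_mul.
split=> //.
  by exists [set g0]; [exact: finite_set1 | rewrite bigcup_set1 => g []].
exists [set g0]; first exact: finite_set1.
by rewrite eqHK bigcup_set1 => _ [[h [_ Kh] <-] _]; exists h.
Qed.
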